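(* Let $B$ be a symmetric endomorphism of a Euclidean vector space $V$, defining the Cahen-Wallach space $M_B$. Any simple irreducible Clifford representation $\rho$ of $M_B$ with $\rho(e_+)=0$ is given by $$\rho(v^* )=\frac1{\sqrt2}\begin{pmatrix}0&Bv\\0&0\end{pmatrix},\quad \rho(w)=-\frac1{\sqrt2}\begin{pmatrix}0&\bar c w-wd\\0&0\end{pmatrix},\quad \rho(e_-)=\begin{pmatrix}\bar c&\sqrt2\,e\\0&d\end{pmatrix}\qquad(v,w\in V)$$ with $c,d,e\in\mathrm{C}\ell(V)$ and $(\bar c,d)$ being a quadratic Clifford pair representing the symmetric map $-B$, i.e. $q_{\bar c,d}(v)=-Bv$ for all $v\in V$. In particular, $e\in \mathrm{C}\ell(V)$ is a free parameter of the representation.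
   Context: $V$ is an $n$-dimensional real vector space, $W=V\oplus\mathbb{R}e_+\oplus\mathbb{R}e_-$ carries the Lorentzian metric $\langle\cdot,\cdot\rangle$ with $g=\langle\cdot,\cdot\rangle|_V$ Euclidean, $e_\pm$ null and orthogonal to $V$, $\langle e_+,e_-\rangle=1$. Write $v^*=\langle v,\cdot\rangle\in V^*$. The Lie algebra of the Cahen-Wallach space $M_B$ is $V^*\oplus W$ with the only non-vanishing brackets $[v^*,w]=-\langle Bv,w\rangle e_+$, $[v^*,e_-]=Bv$, $[e_-,w]=w^*$ for $v,w\in V$. $\mathrm{C}\ell(V)$ is the complex Clifford algebra with $vw+wv=-2g(v,w)$, acting on an irreducible module $S(V)$; $\bar{\ }$ is the automorphism of $\mathrm{C}\ell(V)$ extending $v\mapsto-v$. $\mathrm{C}\ell(W)$ acts on the irreducible module $S=S(V)\oplus S(V)$ by $2\times2$-matrices with entries in $\mathrm{C}\ell(V)$: $e_+\mapsto\begin{pmatrix}0&\sqrt2\\0&0\end{pmatrix}$, $e_-\mapsto\begin{pmatrix}0&0\\-\sqrt2&0\end{pmatrix}$, $v\mapsto\begin{pmatrix}-v&0\\0&v\end{pmatrix}$. A simple irreducible Clifford map of $M_B$ is a linear map $\rho:V^*\oplus W\to\mathrm{C}\ell(W)$, acting on $S$, whose restriction to $V^*$ is the spin representation $\rho(v^* )=\frac1{\sqrt2}\begin{pmatrix}0&Bv\\0&0\end{pmatrix}$ and which is $V^*$-equivariant: $\rho([v^*,x])=[\rho(v^* ),\rho(x)]$ for all $v^*\in V^*$,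 $x\in V^*\oplus W$. It is a Clifford representation if it is a representation of the Lie algebra $V^*\oplus W$ on $S$. For $a,b\in \mathrm{C}\ell(V)$, $q_{a,b}(x)=a^2x+xb^2-2axb$; $(a,b)$ is a quadratic Clifford pair if $q_{a,b}(V)\subset V$ and $q_{a,b}|_V$ is $g$-symmetric.
   Formalization: That every such representation has the stated form is proved for B nondegenerate and V nonzero; otherwise it fails (for w0 in ker B one may add <w0,w>Id to ρ(w); for V = 0, ρ(e_-) is arbitrary). The converse, with e free, is proved for every symmetric B. *)

(* Defs.v *)
From HB Require Import structures.
From mathcomp Require Import all_boot all_order all_algebra.
From mathcomp Require Import sesquilinear reals complex.

Set Implicit Arguments.
Unset Strict Implicit.
Unset Printing Implicit Defensive.

Import Order.TTheory GRing.Theory Num.Theory.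
Local Open Scope ring_scope.
Local Open Scope complex_scope.

Definition rscale (R : realType) (A : algType R[i]) (r : R) (x : A) : A :=
  r%:C *: x.
Definition rconst (R : realType) (A : algType R[i]) (r : R) : A := r%:C%:A.
(* 'M[A]_2 is a module over A, not over R: real scalars act through rconst. *)
Definition rscalemx (R : realType) (A : algType R[i]) (r : R)
  (M : 'M[A]_2) : 'M[A]_2 := rconst A r *: M.

Definition mx22 (A : nzRingType) (a b c d : A) : 'M[A]_2 :=
  \matrix_(i < 2, j < 2)
    if i == 0 then (if j == 0 then a else b) else (if j == 0 then c else d).

Section Helpers.
Variable (R : realType).

Lemma rconstE (A : algType R[i]) (r : R) : rconst A r = in_alg A (real_complex R r).
Proof. by []. Qed.

Lemma rconstM (A : algType R[i]) (r s : R) : rconst A (r * s) = rconst A r * rconst A s.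
Proof. by rewrite !rconstE -!rmorphM. Qed.

Lemma rconstD (A : algType R[i]) (r s : R) : rconst A (r + s) = rconst A r + rconst A s.
Proof. by rewrite !rconstE -!rmorphD. Qed.

Lemma rconstC (A : algType R[i]) (r : R) x : rconst A r * x = x * rconst A r.
Proof. by rewrite !rconstE mulr_algl mulr_algr. Qed.

Variable (A : nzRingType).

Lemma mx22M (a b c d a' b' c' d' : A) : mx22 a b c d *m mx22 a' b' c' d' =
  mx22 (a*a'+b*c') (a*b'+b*d') (c*a'+d*c') (c*b'+d*d').
Proof.
apply/matrixP => i j; rewrite !mxE !big_ord_recl big_ord0 !mxE addr0 /=.
by case: (i == 0); case: (j == 0).
Qed.

Lemma mx22D (a b c d a' b' c' d' : A) : mx22 a b c d + mx22 a' b' c' d' =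
  mx22 (a+a') (b+b') (c+c') (d+d').
Proof.
apply/matrixP => i j; rewrite !mxE.
by case: (i == 0); case: (j == 0).
Qed.

Lemma mx22N (a b c d : A) : - mx22 a b c d = mx22 (-a) (-b) (-c) (-d).
Proof.
apply/matrixP => i j; rewrite !mxE.
by case: (i == 0); case: (j == 0).
Qed.

Lemma mx22s (a : A) : a%:M = mx22 a 0 0 a.
Proof.
apply/matrixP => i j; rewrite !mxE.
by case/orP: (orbN (i == 0)); case: i => [[|[|i]] ?] //; case: j => [[|[|j]] ?].
Qed.

End Helpers.

Section CliffordAlgebra.
Variables (R : realType) (V : vectType R) (g : {dot V for idfun}).

Definition clifford_relation (A : algType R[i]) (f : V -> A) : Prop :=
  GRing.linear_for (@rscale R A) f /\
  forall v w, f v * f w + f w * f v = - rconst A (2 * g v w).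

(* (Cl, gam) is the complex Clifford algebra of (V, g), by its universal
   property; this determines it up to a unique isomorphism. *)
Definition is_clifford_algebra (Cl : algType R[i]) (gam : V -> Cl) : Prop :=
  clifford_relation gam /\
  forall (A : algType R[i]) (f : V -> A), clifford_relation f ->
    exists phi : {lrmorphism Cl -> A},
      (forall v, phi (gam v) = f v) /\
      forall psi : {lrmorphism Cl -> A},
        (forall v, psi (gam v) = f v) -> psi =1 phi.

Variables (Cl : algType R[i]) (gam : V -> Cl).

Definition q_form (a b x : Cl) : Cl := a ^+ 2 * x + x * b ^+ 2 - a * x * b *+ 2.

(* gam is injective, so Q is the restriction of q_form a b to V. *)
Definition quadratic_clifford_pair (a b : Cl) : Prop :=
  exists2 Q : 'End(V), forall v, q_form a b (gam v) = gam (Q v)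
                     & forall v w, g (Q v) w = g v (Q w).

End CliffordAlgebra.

Definition irreducible_module (A : nzRingType) (S : lmodType A) : Prop :=
  (exists s : S, s != 0) /\
  forall N : {pred S}, submod_closed N ->
    (forall s, s \in N -> s = 0) \/ (forall s, s \in N).

Section CahenWallach.
Variables (R : realType) (V : vectType R) (g : {dot V for idfun}).
Variable (B : 'End(V)).

(* v |-> v^* = <v, .>, and its inverse V^* -> V. *)
Definition flat (v : V) : 'Hom(V, R^o) := linfun (g v : V -> R^o).
Definition sharp : 'Hom('Hom(V, R^o), V) := (linfun flat)^-1%VF.

(* W = V + R e_+ + R e_-; (w, a, b) stands for w + a e_+ + b e_-. *)
Definition cwW : lmodType R := (V * R^o * R^o)%type.

Definition cw_alg : lmodType R := ('Hom(V, R^o) * cwW)%type.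

Definition cw_dual (v : V) : cw_alg := (flat v, 0).
Definition cw_vec (w : V) : cw_alg := (0, (w, 0, 0)).
Definition cw_plus : cw_alg := (0, (0, 1, 0)).
Definition cw_minus : cw_alg := (0, (0, 0, 1)).

(* The bilinear antisymmetric extension of [v^*, w] = - <B v, w> e_+,
   [v^*, e_-] = B v, [e_-, w] = w^*. *)
Definition cw_bracket (x y : cw_alg) : cw_alg :=
  let: (phi, (w, _, b)) := x in
  let: (psi, (u, _, c)) := y in
  (b *: flat u - c *: flat w,
   (c *: B (sharp phi) - b *: B (sharp psi),
    g (B (sharp psi)) w - g (B (sharp phi)) u,
    0)).

Definition lorentz (x y : cwW) : R :=
  g x.1.1 y.1.1 + (x.1.2 : R) * y.2 + (x.2 : R) * y.1.2.

Variables (Cl : algType R[i]) (gam : V -> Cl).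

(* The Clifford algebra of W is identified with the algebra of 2 x 2 matrices
   over Cl(V) by means of these images of the vectors of W. *)
Definition gamW (x : cwW) : 'M[Cl]_2 :=
  mx22 (- gam x.1.1) (rconst Cl (Num.sqrt 2 * x.1.2))
       (- rconst Cl (Num.sqrt 2 * x.2)) (gam x.1.1).

Lemma gamW_relation : clifford_relation g gam ->
  forall x y, gamW x *m gamW y + gamW y *m gamW x
              = - (rconst Cl (2 * lorentz x y))%:M.
Proof.
move=> [_ h] [[v a] b] [[w c] d].
rewrite /gamW /lorentz /= mx22s !mx22M mx22D mx22N.
have s2 (x y : R) : rconst Cl (Num.sqrt 2 * x) * rconst Cl (Num.sqrt 2 * y) = rconst Cl (2 * (x * y)).
  by rewrite -rconstM mulrACA -expr2 sqr_sqrtr // ler0n.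
have h1 := h v w.
have -> : 2 * (g v w + a * d + b * c) = 2 * g v w + 2 * (a * d) + 2 * (b * c) :> R.
  by rewrite !mulrDr.
rewrite !(mulrN, mulNr) !opprK !s2 !rconstD !opprD -h1.
have E1 := rconstC (Num.sqrt 2 * a) (gam w).
have E2 := rconstC (Num.sqrt 2 * c) (gam v).
have E3 := rconstC (Num.sqrt 2 * b) (gam w).
have E4 := rconstC (Num.sqrt 2 * d) (gam v).
rewrite E1 E2 E3 E4 (mulrC c b) (mulrC d a).
congr mx22.
- by rewrite addrACA addrA.
- by rewrite oppr0 addrA addrK addNr.
- by rewrite addrA subrK subrr oppr0.
- by rewrite addrACA addrC addrA addrAC.
Qed.

(* S(V) + S(V) as a module over the 2 x 2 matrices. *)
Definition mxact (S : lmodType Cl) (M : 'M[Cl]_2) (s : S * S) : S * S :=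
  (M 0 0 *: s.1 + M 0 1 *: s.2, M 1 0 *: s.1 + M 1 1 *: s.2).

Definition eq_on (S : lmodType Cl) (M N : 'M[Cl]_2) : Prop :=
  forall s : S * S, mxact M s = mxact N s.

Definition mxcomm (M N : 'M[Cl]_2) : 'M[Cl]_2 := M *m N - N *m M.

Definition spin_rep (v : V) : 'M[Cl]_2 :=
  rscalemx (Num.sqrt 2)^-1 (mx22 0 (gam (B v)) 0 0).

(* Below, E is the sense in which elements of Cl(W) are compared: [eq_on S] as
   operators on S(V) + S(V), or [eq] in Cl(W) itself.  The two differ when
   dim V is odd, as Cl(V) does not act faithfully on S(V) then. *)
Variable E : 'M[Cl]_2 -> 'M[Cl]_2 -> Prop.

Definition simple_clifford_map (rho : cw_alg -> 'M[Cl]_2) : Prop :=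
  [/\ GRing.linear_for (@rscalemx R Cl) rho,
      forall v, E (rho (cw_dual v)) (spin_rep v)
    & forall v x, E (rho (cw_bracket (cw_dual v) x))
                    (mxcomm (rho (cw_dual v)) (rho x))].

Definition simple_clifford_rep (rho : cw_alg -> 'M[Cl]_2) : Prop :=
  simple_clifford_map rho /\
  forall x y, E (rho (cw_bracket x y)) (mxcomm (rho x) (rho y)).

Definition given_by (bar : Cl -> Cl) (c d e : Cl)
    (rho : cw_alg -> 'M[Cl]_2) : Prop :=
  [/\ forall v, E (rho (cw_dual v))
        (rscalemx (Num.sqrt 2)^-1 (mx22 0 (gam (B v)) 0 0)),
      forall w, E (rho (cw_vec w))
        (- rscalemx (Num.sqrt 2)^-1 (mx22 0 (bar c * gam w - gam w * d) 0 0))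
    & E (rho cw_minus) (mx22 (bar c) (rscale (Num.sqrt 2) e) 0 d)].

End CahenWallach.

(* Main.v *)
(* Write rho(e_-) as the matrix (a, b; c, d) over Cl(V).  Equivariance gives
   rho(Bv) = [rho(flat v), rho(e_-)], which determines rho on V as B is
   invertible.  Then [rho(flat v), rho(w)] = 0 with w = Bv gives w c w = 0, so
   c = 0, and [rho(e_-), rho(w)] = rho(flat w) becomes q_{a,d}(w) = - Bw.

   When matrices are only compared as operators, all of this holds modulo the
   annihilator I of S(V), a proper two-sided ideal.  Since Cl(V) has no proper
   nonzero ideal stable under bar, I and bar(I) meet in 0, and either I = 0 or
   I + bar(I) = Cl(V).  In the latter case the Chinese remainder theorem gives
   a' and d' congruent to a and d modulo I, and to bar(a) and bar(d) modulo
   bar(I).  As q_{bar a, bar d}(v) = - bar(q_{a,d}(v)), the identity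
   q_{a',d'}(v) = - Bv holds modulo both ideals, hence in Cl(V). *)

From HB Require Import structures.
Require Import Defs.
From mathcomp Require Import all_boot all_order all_algebra.
From mathcomp Require Import boolp sesquilinear reals complex.
Import GRing.Theory Num.Theory.
Local Open Scope ring_scope.
Local Open Scope complex_scope.
Set Implicit Arguments.
Unset Strict Implicit.
Unset Printing Implicit Defensive.

(** * Subalgebras as algebras in their own right *)

Section Subalgebra.
Variables (K : comNzRingType) (A : algType K) (P : subalgClosed A).

(** The universal property of the Clifford algebra quantifies over algebra types, so a subalgebra
    given by a predicate must become a type before it can serve as a target. *)
Record subalgebra :=
  Subalgebra { subalgebra_val : A; _ : subalgebra_val \in P }.

HB.instance Definition _ := [isSub for subalgebra_val].
HB.instance Definition _ := [Choice of subalgebra by <:].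
HB.instance Definition _ := [SubChoice_isSubAlgebra of subalgebra by <:].

Definition subalgebra_incl : subalgebra -> A := val.
HB.instance Definition _ :=
  GRing.RMorphism.copy subalgebra_incl (val : subalgebra -> A).
HB.instance Definition _ :=
  GRing.Linear.copy subalgebra_incl (val : subalgebra -> A).
End Subalgebra.

(** * Congruence modulo a two-sided ideal, for elements and entrywise for matrices *)

Section Congruence.
Variable A : nzRingType.

Definition two_sided_ideal (I : A -> Prop) : Prop :=
  [/\ I 0, forall x y, I x -> I y -> I (x + y),
      forall a x, I x -> I (a * x) & forall a x, I x -> I (x * a)].

Variable I : A -> Prop.
Hypothesis I_ideal : two_sided_ideal I.

Definition congr_mod (x y : A) : Prop := I (x - y).

Lemma idealN x : I x -> I (- x).
Proof. by case: I_ideal => _ _ IMl _; rewrite -mulN1r; apply: IMl. Qed.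

Lemma congr_mod_refl x : congr_mod x x.
Proof. by case: I_ideal => I0 _ _ _; rewrite /congr_mod subrr. Qed.

Lemma congr_mod_sym x y : congr_mod x y -> congr_mod y x.
Proof. by move/idealN; rewrite opprB. Qed.

Lemma congr_mod_trans y x z : congr_mod x y -> congr_mod y z -> congr_mod x z.
Proof.
case: I_ideal => _ ID _ _ xy yz.
by rewrite /congr_mod -(subrK y x) -addrA; apply: ID.
Qed.

Lemma congr_modD x x' y y' :
  congr_mod x x' -> congr_mod y y' -> congr_mod (x + y) (x' + y').
Proof.
case: I_ideal => _ ID _ _ xx yy.
by rewrite /congr_mod opprD addrACA; apply: ID.
Qed.

Lemma congr_modN x x' : congr_mod x x' -> congr_mod (- x) (- x').
Proof. by move/idealN; rewrite opprD. Qed.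

Lemma congr_modM x x' y y' :
  congr_mod x x' -> congr_mod y y' -> congr_mod (x * y) (x' * y').
Proof.
case: I_ideal => _ _ IMl IMr xx yy; apply: (@congr_mod_trans (x * y')).
  by rewrite /congr_mod -mulrBr; apply: IMl.
by rewrite /congr_mod -mulrBl; apply: IMr.
Qed.

Definition mx_congr_mod m n (M N : 'M[A]_(m, n)) : Prop :=
  forall i j, congr_mod (M i j) (N i j).

Lemma mx_congr_modM m n p (M M' : 'M_(m, n)) (N N' : 'M_(n, p)) :
  mx_congr_mod M M' -> mx_congr_mod N N' -> mx_congr_mod (M *m N) (M' *m N').
Proof.
move=> MM NN i j; rewrite !mxE.
elim/big_ind2: _ => [|x x' y y' xx yy|k _]; first exact: congr_mod_refl.
  exact: congr_modD.
exact: congr_modM.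
Qed.

Lemma mx_congr_mod_sym m n (M N : 'M_(m, n)) :
  mx_congr_mod M N -> mx_congr_mod N M.
Proof. by move=> MN i j; apply/congr_mod_sym/MN. Qed.

Lemma mx_congr_mod_trans m n (N M P : 'M_(m, n)) :
  mx_congr_mod M N -> mx_congr_mod N P -> mx_congr_mod M P.
Proof. by move=> MN NP i j; apply: congr_mod_trans (MN i j) (NP i j). Qed.

Lemma mx_congr_mod22 (a b c d a' b' c' d' : A) :
    congr_mod a a' -> congr_mod b b' -> congr_mod c c' -> congr_mod d d' ->
  mx_congr_mod (mx22 a b c d) (mx22 a' b' c' d').
Proof.
by move=> *; move=> i j; rewrite !mxE; case: (i == 0); case: (j == 0).
Qed.

End Congruence.

Lemma mx22_eta (A : nzRingType) (M : 'M[A]_2) :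
  M = mx22 (M 0 0) (M 0 1) (M 1 0) (M 1 1).
Proof.
apply/matrixP => i j; rewrite !mxE.
by case: i => [[|[|//]] i2]; case: j => [[|[|//]] j2] /=; congr (M _ _);
  apply: val_inj.
Qed.

(** * Commutators of 2 x 2 matrices and the quadratic map [q_form] *)

Section CliffordMatrices.
Variables (R : realType) (Cl : algType R[i]).
Implicit Types a b c d : Cl.

Lemma rscalemx_mx22 (r : R) a b c d : rscalemx r (mx22 a b c d) =
  mx22 (r%:C *: a) (r%:C *: b) (r%:C *: c) (r%:C *: d).
Proof.
apply/matrixP => i j; rewrite !mxE /rconst.
by case: (i == 0); case: (j == 0); rewrite mulr_algl.
Qed.

Lemma mx_congr_mod_comm (I : Cl -> Prop) (M M' N N' : 'M[Cl]_2) :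
    two_sided_ideal I -> mx_congr_mod I M M' -> mx_congr_mod I N N' ->
  mx_congr_mod I (mxcomm M N) (mxcomm M' N').
Proof.
move=> I_ideal MM NN i j; rewrite !mxE.
have := mx_congr_modM I_ideal MM NN i j; rewrite !mxE => MN.
have := mx_congr_modM I_ideal NN MM i j; rewrite !mxE => NM.
exact/(congr_modD I_ideal)/(congr_modN I_ideal).
Qed.

Lemma mxcomm_mx22 a b c d a' b' c' d' :
  mxcomm (mx22 a b c d) (mx22 a' b' c' d') =
  mx22 (a * a' + b * c' - (a' * a + b' * c))
       (a * b' + b * d' - (a' * b + b' * d))
       (c * a' + d * c' - (c' * a + d' * c))
       (c * b' + d * d' - (c' * b + d' * d)).
Proof. by rewrite /mxcomm !mx22M mx22N mx22D. Qed.

Lemma q_form_congr (I : Cl -> Prop) a b a' b' x : two_sided_ideal I ->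
    congr_mod I a a' -> congr_mod I b b' ->
  congr_mod I (q_form a b x) (q_form a' b' x).
Proof.
move=> iI aa bb; rewrite /q_form !expr2 !mulr2n.
have xx := congr_mod_refl iI x.
have axb := congr_modM iI (congr_modM iI aa xx) bb.
apply: (congr_modD iI) (congr_modN iI (congr_modD iI axb axb)).
by apply: (congr_modD iI); apply: (congr_modM iI) => //; apply: (congr_modM iI).
Qed.

(* [q_form a b] is the square of the linear map [x |-> a x - x b]. *)
Lemma q_formE a b x :
  q_form a b x = a * (a * x - x * b) - (a * x - x * b) * b.
Proof.
rewrite /q_form !expr2 mulrBr mulrBl opprB !mulrA mulr2n opprD.
by rewrite addrACA.
Qed.

End CliffordMatrices.

(** * Gram-Schmidt orthogonalization *)

Section GramSchmidt.
Variables (R : realType) (V : vectType R) (g : {dot V for idfun}).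

Lemma dot_gt0 v : v != 0 -> 0 < g v v.
Proof. exact: neq0_dnorm_gt0. Qed.

Definition orthogonal_seq (s : seq V) :=
  (0 \notin s) && pairwise (fun u v => g u v == 0) s.

(** Induction on [s]: the projection onto the tail is corrected by the component of the residue
    along the head [f]. As [f] is orthogonal to the tail, the correction preserves the orthogonality
    already obtained. *)
Lemma orthogonal_projection (s : seq V) (v : V) : orthogonal_seq s ->
  exists2 p, p \in <<s>>%VS & {in s, forall e, g e (v - p) = 0}.
Proof.
rewrite /orthogonal_seq; elim: s => [|f s IHs] /=.
  by exists 0; rewrite ?mem0v.
rewrite inE negb_or eq_sym => /andP[/andP[f0 s0] /andP[f_s s_orth]].
have [|p s_p p_orth] := IHs; first by rewrite s0.
have gf := lt0r_neq0 (dot_gt0 f0).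
exists (p + (g f (v - p) / g f f) *: f).
  rewrite span_cons addrC memv_add ?memvZ ?memv_line //.
move=> e; rewrite inE opprD addrA linearBr linearZr_LR /=.
case/predU1P=> [->|s_e]; first by rewrite divfK // subrr.
have /eqP gfe := allP f_s e s_e.
by rewrite p_orth // [g e f]hermC /= gfe !mulr0 subrr.
Qed.

(** Each new vector [v] is replaced by its residue [v - p], which leaves the span unchanged; a zero
    residue is dropped, since an orthogonal sequence consists of nonzero vectors. *)
Lemma orthogonal_spanning_seq :
  exists2 s : seq V, <<s>>%VS = fullv & orthogonal_seq s.
Proof.
suff gs (X : seq V) : exists2 s : seq V, <<s>>%VS = <<X>>%VS & orthogonal_seq s.
  have [s ss s_orth] := gs (vbasis {:V}).
  by exists s => //; rewrite ss (span_basis (vbasisP _)).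
elim: X => [|v X [s ss s_orth]]; first by exists [::].
have [p s_p p_orth] := orthogonal_projection v s_orth.
have spanE : <<v - p :: s>>%VS = <<v :: X>>%VS.
  apply/eqP; rewrite eqEsubv !span_cons -ss !subv_add !addvSr -!memvE.
  have vU : v \in (<[v]> + <<s>>)%VS by rewrite (subvP (addvSl _ _)) ?memv_line.
  have pU : p \in (<[v]> + <<s>>)%VS by rewrite (subvP (addvSr _ _)).
  rewrite memvB //= -[v in v \in _](subrK p).
  rewrite memvD ?(subvP (addvSl _ _) _ (memv_line _)) //.
  by rewrite (subvP (addvSr _ _)).
have [vp0 | vp0] := eqVneq (v - p) 0.
  exists s => //; rewrite -spanE vp0 span_cons.
  by rewrite (_ : <[0]>%VS = 0%VS) ?add0v.
exists (v - p :: s) => //; move: s_orth; rewrite /orthogonal_seq /= inE negb_or.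
rewrite eq_sym vp0 => /andP[-> ->]; rewrite /= andbT; apply/allP => e s_e.
by rewrite hermC /= p_orth //= mulr0.
Qed.

End GramSchmidt.

Lemma rmorph_rconst (R : realType) (A A' : algType R[i])
  (f : {lrmorphism A -> A'}) r : f (rconst A r) = rconst A' r.
Proof. exact: rmorph_alg. Qed.

(** * Structure of the Clifford algebra, derived from its universal property *)

Section CliffordAlgebraTheory.
Variables (R : realType) (V : vectType R) (g : {dot V for idfun}).
Variables (Cl : algType R[i]) (gam : V -> Cl).
Hypothesis Cl_V : is_clifford_algebra g gam.

(** Both morphisms extend the Clifford map [f \o gam], and such an extension is unique. *)
Lemma clifford_hom_ext (f h : {lrmorphism Cl -> Cl}) :
  (forall v, f (gam v) = h (gam v)) -> f =1 h.
Proof.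
move=> fh.
have lin_f : linear_for (@rscale R Cl) (f \o gam).
  by move=> a u v /=; rewrite Cl_V.1.1 linearD linearZ.
have rel_f : clifford_relation g (f \o gam).
  split=> // v w /=; rewrite -!rmorphM -rmorphD Cl_V.1.2 rmorphN /=.
  by rewrite rmorph_rconst.
have [phi [_ phi_uniq]] := Cl_V.2 _ _ rel_f.
move=> x; rewrite (phi_uniq f) // (phi_uniq h) // => v.
by rewrite -fh.
Qed.

(** The elements satisfying [P] form a subalgebra containing [gam v] for all [v], so [gam] extends
    to a morphism from [Cl] into it. Followed by the inclusion, this morphism fixes every [gam v]
    and is therefore the identity. *)
Lemma clifford_ind (P : Cl -> Prop) :
    P 1 -> (forall a x y, P x -> P y -> P (a *: x + y)) ->
    (forall x y, P x -> P y -> P (x * y)) -> (forall v, P (gam v)) ->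
  forall x, P x.
Proof.
move=> P1 PZD PM PV.
pose Q : {pred Cl} := fun x => `[<P x>].
have Q_closed : subalg_closed Q.
  split; first exact/asboolP.
    by move=> a x y /asboolP Px /asboolP Py; apply/asboolP/PZD.
  by move=> x y /asboolP Px /asboolP Py; apply/asboolP/PM.
have QV v : gam v \in Q by apply/asboolP.
pose QS : subalgClosed Cl :=
  HB.pack Q (GRing.isSubalgClosed.Build R[i] Cl Q Q_closed).
pose f v : subalgebra QS := @Subalgebra _ _ QS _ (QV v).
pose incl : {lrmorphism subalgebra QS -> Cl} := @subalgebra_incl _ _ QS.
have incl_inj : injective incl by apply: val_inj.
have rel_f : clifford_relation g f.
  split=> [a u v|v w]; apply: incl_inj.
    by rewrite linearD linearZ; apply: Cl_V.1.1.
  rewrite rmorphD !rmorphM rmorphN /= rmorph_rconst.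
  exact: Cl_V.1.2.
have [phi [phi_gam _]] := Cl_V.2 _ _ rel_f.
move=> x.
have -> : x = incl (phi x).
  apply: (clifford_hom_ext (f := idfun) (h := incl \o phi)) => v /=.
  by rewrite phi_gam.
by case: (phi x) => y /= Qy; apply/asboolP.
Qed.

Lemma gamD u v : gam (u + v) = gam u + gam v.
Proof. by rewrite -[u in LHS]scale1r Cl_V.1.1 /rscale rmorph1 scale1r. Qed.

Lemma gamZ a v : gam (a *: v) = a%:C *: gam v.
Proof.
have gam0 : gam 0 = 0 by apply: (addrI (gam 0)); rewrite -gamD !addr0.
by rewrite -[a *: v]addr0 Cl_V.1.1 gam0 addr0.
Qed.

Lemma gamN v : gam (- v) = - gam v.
Proof. by rewrite -scaleN1r gamZ rmorphN1 scaleN1r. Qed.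

Lemma gam_sqr v : gam v * gam v = - rconst Cl (g v v).
Proof.
have two0 : (2 : R[i]) != 0 by rewrite pnatr_eq0.
apply: (scalerI two0); rewrite scaler_nat mulr2n Cl_V.1.2.
by rewrite scalerN rconstM /rconst mulr_algl rmorph_nat.
Qed.

Lemma gam_anticomm u v : g u v = 0 -> gam u * gam v = - (gam v * gam u).
Proof.
move=> guv; apply/eqP; rewrite -addr_eq0 Cl_V.1.2 guv mulr0 /rconst.
by rewrite rmorph0 scale0r oppr0.
Qed.

(** The complex span of the products of [gam e] over the subsequences of [s], taken in order. Only
    the existence of an expansion is asserted, not linear independence of the products. *)
Fixpoint monomial_span (s : seq V) (x : Cl) : Prop :=
  if s is e :: s' then
    exists a b, [/\ monomial_span s' a, monomial_span s' b & x = a + gam e * b]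
  else exists k : R[i], x = k%:A.

Lemma monomial_spanP s a x y :
  monomial_span s x -> monomial_span s y -> monomial_span s (a *: x + y).
Proof.
elim: s x y => [|e s IHs] x y /=.
  by move=> [k ->] [l ->]; exists (a * k + l); rewrite scalerDl scalerA.
move=> [b [c [Sb Sc ->]]] [b' [c' [Sb' Sc' ->]]].
exists (a *: b + b'), (a *: c + c'); split; [exact: IHs | exact: IHs |].
by rewrite scalerDr mulrDr -scalerAr addrACA.
Qed.

Lemma monomial_span_alg s (k : R[i]) : monomial_span s (k%:A).
Proof.
elim: s k => [|e s IHs] k /=; first by exists k.
exists k%:A, 0; split=> //; last by rewrite mulr0 addr0.
by have := IHs 0; rewrite scale0r.
Qed.

Lemma monomial_spanZ s a x : monomial_span s x -> monomial_span s (a *: x).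
Proof.
move=> Sx; rewrite -[_ *: _]addr0; apply: monomial_spanP => //.
by have := monomial_span_alg s 0; rewrite scale0r.
Qed.

Lemma monomial_spanD s x y :
  monomial_span s x -> monomial_span s y -> monomial_span s (x + y).
Proof. by move=> Sx; rewrite -[x]scale1r; apply: monomial_spanP. Qed.

Lemma monomial_span_gamM s e x :
  e \in s -> monomial_span s x -> monomial_span s (gam e * x).
Proof.
elim: s x => [|f s IHs] // x; rewrite inE => s_e /= [a [b [Sa Sb ->]]].
have [-> | nef] := eqVneq e f.
  (* As [gam f] squares to a scalar, multiplication by it exchanges the two components. *)
  exists (- (g f f)%:C *: b), a; split=> //; first exact: monomial_spanZ.
  by rewrite mulrDr mulrA gam_sqr mulNr /rconst mulr_algl scaleNr addrC.
have {}s_e : e \in s by rewrite (negPf nef) in s_e.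
(* Moving [gam e] to the right past [gam f] changes the sign and leaves the scalar [- 2 g e f],
   which joins the first component. *)
exists (gam e * a + (- (2 * g e f))%:C *: b), (- (gam e * b)); split.
- by apply: monomial_spanD (monomial_spanZ _ _); first exact: IHs.
- by rewrite -scaleN1r; apply/monomial_spanZ/IHs.
rewrite mulrDr -addrA; congr (_ + _).
rewrite mulrA -[gam e * gam f](addrK (gam f * gam e)) Cl_V.1.2.
by rewrite mulrBl mulNr /rconst mulr_algl rmorphN scaleNr mulrN mulrA.
Qed.

(** The span contains 1 and is stable under left multiplication by any element; by [clifford_ind]
    stability has to be checked only for vectors, which are combinations of members of [s]. *)
Lemma monomial_span_full s : <<s>>%VS = fullv -> forall x, monomial_span s x.
Proof.
move=> s_full x.
suff Sxy y : monomial_span s y -> monomial_span s (x * y).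
  rewrite -[x]mulr1; apply: Sxy; rewrite -[1]scale1r.
  exact: monomial_span_alg.
elim/clifford_ind: x y => [y|a x x' IHx IHx' y Sy|x x' IHx IHx' y Sy|v y Sy].
- by rewrite mul1r.
- by rewrite mulrDl -scalerAl; apply: monomial_spanP;
    [apply: IHx | apply: IHx'].
- by rewrite -mulrA; apply/IHx/IHx'.
have: v \in <<in_tuple s>>%VS by rewrite s_full memvf.
move/coord_span=> ->.
elim/big_ind: _ => [|u w Su Sw|i _].
- by have := monomial_span_alg s 0;
    rewrite -(scale0r (0 : V)) gamZ rmorph0 !scale0r mul0r.
- by rewrite gamD mulrDl; apply: monomial_spanD.
rewrite gamZ -scalerAl; apply/monomial_spanZ/monomial_span_gamM => //.
exact: mem_nth.
Qed.

Variables (bar : {lrmorphism Cl -> Cl}).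
Hypothesis bar_V : forall v, bar (gam v) = - gam v.

Lemma barK : involutive bar.
Proof.
apply: (clifford_hom_ext (f := bar \o bar) (h := idfun)) => v /=.
by rewrite bar_V rmorphN /= bar_V opprK.
Qed.

(** A vector orthogonal to all of [s] passes a monomial of length k with the sign (-1)^k, which is
    also the sign that [bar] gives to this monomial. *)
Lemma gam_bar_comm e s x :
    all (fun f => g e f == 0) s -> monomial_span s x ->
  gam e * bar x = x * gam e.
Proof.
elim: s x => [|f s IHs] x /=.
  by move=> _ [k ->]; rewrite rmorph_alg mulr_algl mulr_algr.
move=> /andP[/eqP gef e_s] [a [b [Sa Sb ->]]].
rewrite rmorphD rmorphM /= bar_V mulrDr mulrDl (IHs a) //; congr (_ + _).
by rewrite -mulrA -IHs // !mulrA mulrN (gam_anticomm gef) opprK.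
Qed.

(* For [a], [b] in the span of monomials avoiding [e], [x = a + e b] gives
   [e bar(x) e = |e|^2 (- a + e b)], so a graded ideal containing [x] contains
   [a] and [b]. *)
Lemma graded_ideal_trivial (J : Cl -> Prop) :
    two_sided_ideal J -> (forall x, J x -> J (bar x)) -> ~ J 1 ->
  forall x, J x -> x = 0.
Proof.
move=> [J0 JD JMl JMr] Jbar J1.
have JZ (k : R[i]) x : J x -> J (k *: x) by rewrite -mulr_algl; apply: JMl.
have JZV (k : R[i]) x : k != 0 -> J (k *: x) -> J x.
  by move=> k0 /(JZ k^-1); rewrite scalerA mulVf // scale1r.
have [s s_full s_orth] := orthogonal_spanning_seq g.
suff Js (x : Cl) : monomial_span s x -> J x -> x = 0.
  by move=> x; apply/Js/monomial_span_full.
elim: s {s_full} s_orth x => [_ x /= [k ->] Jk|e s IHs].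
  (* Over the empty sequence only scalars occur, and a nonzero scalar in [J] would put 1 in [J]. *)
  have [->|k0] := eqVneq k 0; first by rewrite scale0r.
  by case: J1; apply: JZV Jk.
rewrite /orthogonal_seq /= inE negb_or eq_sym.
move=> /andP[/andP[e0 s0] /andP[e_s s_orth]] x [a [b [Sa Sb ->]]] Jx.
have {}IHs y : monomial_span s y -> J y -> y = 0.
  by apply: IHs; rewrite /orthogonal_seq s0 s_orth.
have e2 : (g e e)%:C != 0 by rewrite fmorph_eq0 lt0r_neq0 // dot_gt0.
have ee y : gam e * (gam e * y) = - (g e e)%:C *: y.
  by rewrite mulrA gam_sqr // mulNr mulr_algl scaleNr.
have exe : gam e * bar (a + gam e * b) * gam e =
    (g e e)%:C *: (- a + gam e * b).
  rewrite rmorphD rmorphM /= bar_V mulrDr (gam_bar_comm e_s) // mulNr mulrN ee.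
  have be : bar b * gam e = gam e * b.
    apply: (inv_inj barK); rewrite !rmorphM /= barK bar_V mulrN mulNr.
    by rewrite (gam_bar_comm e_s).
  rewrite scaleNr opprK mulrDl -mulrA gam_sqr // -scalerAl be mulrN.
  by rewrite /rconst mulr_algr scalerDr scalerN.
have a0 : a = 0.
  apply: IHs => //; apply: (JZV (2 * (g e e)%:C)).
    by rewrite mulf_neq0 // pnatr_eq0.
  have := JMr (gam e) _ (JMl (gam e) _ (Jbar _ Jx)).
  rewrite exe => /(JZ (-1))/(JD _ _ (JZ (g e e)%:C _ Jx)).
  rewrite scaleN1r -scalerN opprD opprK -scalerDr addrACA subrr addr0.
  by rewrite -mulr2n -scaler_nat scalerA mulrC.
move: Jx; rewrite a0 add0r => /(JMl (gam e)); rewrite ee => Jb.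
by rewrite (IHs b) ?mulr0 //; apply: JZV Jb; rewrite oppr_eq0.
Qed.

(** The intersection of I and bar(I) is a [bar]-stable ideal without 1, so [graded_ideal_trivial]
    applies. *)
Lemma two_sided_ideal_disjoint (I : Cl -> Prop) : two_sided_ideal I -> ~ I 1 ->
  forall x, I x -> I (bar x) -> x = 0.
Proof.
move=> [I0 ID IMl IMr] I1 x Ix Ibx.
apply: (graded_ideal_trivial (J := fun x => I x /\ I (bar x))) => //.
- split=> [|y z [Iy Iby] [Iz Ibz]|y z [Iz Ibz]|y z [Iz Ibz]].
  + by rewrite rmorph0.
  + by rewrite rmorphD; split; apply: ID.
  + by rewrite rmorphM; split; apply: IMl.
  + by rewrite rmorphM; split; apply: IMr.
- by move=> y [Iy Iby]; rewrite barK.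
- by case.
Qed.

(** The sum I + bar(I) is a [bar]-stable ideal; membership of [x] is written as [x = u + (x - u)]
    with [u] in I and [x - u] in bar(I). Either it contains 1, or it vanishes and I with it. *)
Lemma two_sided_ideal_zero_or_comaximal (I : Cl -> Prop) : two_sided_ideal I ->
  (forall x, I x -> x = 0) \/ exists2 u, I u & I (bar (1 - u)).
Proof.
move=> [I0 ID IMl IMr].
have [|no_u] := pselect (exists2 u, I u & I (bar (1 - u))); [by right | left].
move=> x Ix.
apply: (graded_ideal_trivial
          (J := fun x => exists2 u, I u & I (bar (x - u)))) => //.
- split=> [|y z [u Iu Iyu] [v Iv Izv]|y z [v Iv Izv]|y z [v Iv Izv]].
  + by exists 0 => //; rewrite subr0 rmorph0.
  + by exists (u + v); [apply: ID | rewrite opprD addrACA rmorphD; apply: ID].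
  + by exists (y * v); [apply: IMl | rewrite -mulrBr rmorphM; apply: IMl].
  + by exists (v * y); [apply: IMr | rewrite -mulrBl rmorphM; apply: IMr].
(* Applying [bar] exchanges the roles of the two summands. *)
- move=> y [u Iu Iyu]; exists (bar (y - u)) => //.
  by rewrite -rmorphB /= subKr barK.
- by exists x => //; rewrite subrr rmorph0.
Qed.

Lemma q_form_bar a b v :
  q_form (bar a) (bar b) (gam v) = - bar (q_form a b (gam v)).
Proof.
rewrite /q_form !expr2 rmorphB rmorphD rmorphMn /= !rmorphM /= bar_V.
by rewrite !mulrN !mulNr mulNrn !opprD !opprK.
Qed.

(** A single lift of [a] and [b] serves all [v] and [w]. It matters that the value is a vector:
    [bar] negates it, which matches the sign in [q_form_bar]. *)
Lemma clifford_pair_lift (I : Cl -> Prop) a b : two_sided_ideal I -> ~ I 1 ->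
  exists a' b', [/\ congr_mod I a' a, congr_mod I b' b
    & forall v w, congr_mod I (q_form a b (gam v)) (gam w) ->
        q_form a' b' (gam v) = gam w].
Proof.
move=> iI I1.
have [I0|[u Iu Ibu]] := two_sided_ideal_zero_or_comaximal iI.
  exists a, b; split; [exact: congr_mod_refl | exact: congr_mod_refl |].
  by move=> v w /I0/eqP; rewrite subr_eq0 => /eqP.
pose J x := I (bar x).
have iJ : two_sided_ideal J.
  case: iI => I0 ID IMl IMr.
  split=> [|x y|c x|c x]; rewrite /J ?rmorph0 ?rmorphD ?rmorphM //.
  - exact: ID.
  - exact: IMl.
  - exact: IMr.
(* Chinese remainder: [u] is 0 modulo [I] and 1 modulo [J], so [l x] is congruent to [x] modulo [I]
   and to [bar x] modulo [J]. *)
pose l x := x * (1 - u) + bar x * u.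
have lI x : congr_mod I (l x) x.
  case: iI => _ _ IMl _; rewrite /congr_mod /l mulrBr mulr1 addrAC.
  by rewrite [x - _]addrC addrK addrC -mulrBl; apply: IMl.
have lJ x : congr_mod J (l x) (bar x).
  case: iJ => _ _ JMl _; rewrite /congr_mod /l.
  have -> : x * (1 - u) + bar x * u - bar x = (x - bar x) * (1 - u).
    by rewrite mulrBl [bar x * (1 - u)]mulrBr mulr1 opprB addrA.
  exact: JMl.
exists (l a), (l b); split=> // v w qI.
apply/eqP; rewrite -subr_eq0; apply/eqP.
apply: (two_sided_ideal_disjoint iI) => //.
  exact: (congr_mod_trans iI (q_form_congr (gam v) iI (lI a) (lI b)) qI).
rewrite -[I _]/(congr_mod J _ _).
apply: (congr_mod_trans iJ (q_form_congr (gam v) iJ (lJ a) (lJ b))).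
rewrite /congr_mod q_form_bar /J -[gam w]opprK -bar_V -opprD -rmorphB.
by rewrite rmorphN /= barK; apply: idealN.
Qed.

End CliffordAlgebraTheory.

(** * The Lie algebra of the Cahen-Wallach space and its representations *)

Section CahenWallachTheory.
Variables (R : realType) (V : vectType R) (g : {dot V for idfun}).
Variable B : 'End(V).

Lemma flatE v w : flat g v w = g v w.
Proof. by rewrite lfunE. Qed.

Lemma flat_linear : linear (flat g).
Proof.
move=> a u v; apply/lfunP => w; rewrite add_lfunE scale_lfunE !flatE.
by rewrite linearDl linearZl_LR.
Qed.

(** [sharp] inverts [linfun flat], which agrees with [flat] once [flat] is known to be linear. *)
HB.instance Definition _ := GRing.isLinear.Build R V 'Hom(V, R^o) *:%R (flat g)
  flat_linear.

Lemma flat_inj : injective (flat g).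
Proof.
move=> u v fuv; apply/eqP; rewrite -subr_eq0; apply: contraT => /dot_gt0.
have /lfunP/(_ (u - v)) := fuv; rewrite !flatE => guv.
move=> /(_ g); rewrite linearBl [X in X - _]guv subrr.
by rewrite Order.POrderTheory.ltxx.
Qed.

Lemma flatK : cancel (flat g) (sharp g).
Proof.
move=> v; rewrite /sharp -[flat g v]lfunE lker0_lfunK //.
by apply/lker0P => u w; rewrite !lfunE; apply: flat_inj.
Qed.

Let B_sharp0 : B (sharp g 0) = 0. Proof. by rewrite !linear0. Qed.
Let g0r u : g u 0 = 0. Proof. exact: linear0r. Qed.
Let g0l u : g 0 u = 0. Proof. exact: linear0l. Qed.

Lemma cw_bracket_dual_minus v :
  cw_bracket g B (cw_dual g v) (cw_minus V) = cw_vec (B v).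
Proof.
rewrite /cw_bracket /cw_dual /cw_minus /cw_vec /= flatK B_sharp0 !g0r linear0.
by rewrite !scale1r !scaler0 !subr0.
Qed.

Lemma cw_bracket_dual_vec v w :
  cw_bracket g B (cw_dual g v) (cw_vec w) = - g (B v) w *: cw_plus V.
Proof.
rewrite /cw_bracket /cw_dual /cw_plus /cw_vec /= flatK B_sharp0 !g0r linear0.
rewrite !scale0r !subr0 sub0r.
by congr (_, (_, _, _)); rewrite /= ?scaler0 ?mulr0 // [RHS]mulr1.
Qed.

Lemma cw_bracket_minus_vec w :
  cw_bracket g B (cw_minus V) (cw_vec w) = cw_dual g w.
Proof.
rewrite /cw_bracket /cw_dual /cw_minus /cw_vec /= B_sharp0 !g0r g0l linear0.
by rewrite !scaler0 !subr0 scale1r.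
Qed.

Variables (Cl : algType R[i]) (gam : V -> Cl).
Hypothesis Cl_V : is_clifford_algebra g gam.
Variable bar : {lrmorphism Cl -> Cl}.
Hypothesis bar_V : forall v, bar (gam v) = - gam v.

(** The ideal [I] lets one argument treat both comparisons of matrices: the annihilator of S(V) for
    operators, the zero ideal for equality in Cl(W). *)
Lemma clifford_rep_normal_form (I : Cl -> Prop)
    (E : 'M[Cl]_2 -> 'M[Cl]_2 -> Prop) (rho : cw_alg V -> 'M[Cl]_2) :
    two_sided_ideal I -> ~ I 1 ->
    (forall M N, E M N <-> mx_congr_mod I M N) ->
    (0 < \dim {:V})%N -> lker B == 0%VS ->
    simple_clifford_rep g B gam E rho -> E (rho (cw_plus V)) 0 ->
  exists c d e, given_by g B gam E bar c d e rho /\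
    forall v, q_form (bar c) d (gam v) = - gam (B v).
Proof.
move=> iI I1 EI dimV kerB [[rho_lin rho_dual _] rho_rep] rho_plus.
set k := ((Num.sqrt 2)^-1 : R).
have k0 : k%:C != 0.
  by rewrite fmorph_eq0 invr_eq0 lt0r_neq0 // sqrtr_gt0 ltr0n.
have IZ (a : R[i]) x : I x -> I (a *: x).
  by case: iI => _ _ IMl _; rewrite -mulr_algl; apply: IMl.
have IZV (a : R[i]) x : a != 0 -> I (a *: x) -> I x.
  by move=> a0 /(IZ a^-1); rewrite scalerA mulVf // scale1r.
pose al := rho (cw_minus V) 0 0; pose be := rho (cw_minus V) 0 1.
pose ga := rho (cw_minus V) 1 0; pose de := rho (cw_minus V) 1 1.
have rho_minus : rho (cw_minus V) = mx22 al be ga de by apply: mx22_eta.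
pose N w := mx22 0 (k%:C *: gam w) 0 0.
have rho_dualI v : mx_congr_mod I (rho (cw_dual g v)) (N (B v)).
  by move/EI: (rho_dual v); rewrite /spin_rep rscalemx_mx22 !scaler0.
have comm_congr := mx_congr_mod_comm iI.
have refl_congr (M : 'M_2) : mx_congr_mod I M M.
  by move=> i j; apply: congr_mod_refl.
have rho_vec w :
    mx_congr_mod I (rho (cw_vec w)) (mxcomm (N w) (mx22 al be ga de)).
  (* Writing [w] as [B v] makes it the bracket of [cw_dual g v] and [cw_minus V]. *)
  rewrite -[w](lker0_lfunVK kerB); move: (_ w) => v.
  rewrite -rho_minus -cw_bracket_dual_minus.
  move/EI: (rho_rep (cw_dual g v) (cw_minus V)) => rhoI.
  by apply: (mx_congr_mod_trans iI rhoI); apply: comm_congr.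
have simpl0 := (mul0r, mulr0, add0r, addr0, subr0, sub0r).
have comm_N w : mxcomm (N w) (mx22 al be ga de) =
    mx22 (k%:C *: gam w * ga) (k%:C *: gam w * de - al * (k%:C *: gam w))
         0 (- (ga * (k%:C *: gam w))).
  by rewrite /N mxcomm_mx22 !simpl0 oppr0.
have rho0 : rho 0 = 0.
  apply: (addrI (rho 0)); rewrite addr0 -[in RHS](addr0 0) -[in RHS](scale1r 0).
  by rewrite rho_lin /rscalemx /rconst rmorph1 !scale1r.
(* For nonzero [w], [W] squares to an invertible scalar, so [ga] is a scalar multiple of
   [W * (W * ga * W) * W]. *)
have ga_I : I ga.
  have [w w0] : exists w : V, w != 0.
    by exists (vpick fullv); rewrite vpick0 -dimv_eq0 -lt0n.
  have gw : (g w w)%:C != 0 by rewrite fmorph_eq0 lt0r_neq0 // dot_gt0.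
  set W := k%:C *: gam w.
  have WW : W * W = - (k%:C * k%:C * (g w w)%:C) *: 1.
    rewrite -scalerAl -scalerAr (gam_sqr Cl_V) /rconst !scalerN !scalerA.
    by rewrite scaleNr.
  have WI : I (W * ga * W).
    pose v : V := (B^-1 w)%VF.
    (* This bracket is a multiple of [cw_plus V], on which [rho] vanishes modulo [I]. *)
    have rho_bracket :
        mx_congr_mod I (rho (cw_bracket g B (cw_dual g v) (cw_vec w))) 0.
      rewrite cw_bracket_dual_vec -[_ *: _]addr0 rho_lin rho0 addr0.
      move=> i j; rewrite /congr_mod !mxE subr0.
      case: iI => _ _ IMl _; apply: IMl.
      by have /EI/(_ i j) := rho_plus; rewrite /congr_mod mxE subr0.
    have /EI rhoI := rho_rep (cw_dual g v) (cw_vec w).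
    have := mx_congr_mod_trans iI (mx_congr_mod_sym iI rho_bracket) rhoI.
    move/(mx_congr_mod_trans iI)
      /(_ (comm_congr _ _ _ _ (rho_dualI v) (rho_vec w))).
    rewrite lker0_lfunVK // comm_N mxcomm_mx22 => /(_ 0 1).
    (* The upper right entry of the commutator is [- 2 W ga W]. *)
    rewrite /congr_mod !mxE /= !simpl0 mulrN -opprD opprK mulrA -mulr2n.
    by rewrite -scaler_nat; apply: IZV; rewrite pnatr_eq0.
  case: iI => _ _ IMl IMr; have := IMr W _ (IMl W _ WI); clearbody W.
  rewrite !mulrA WW mulr_algl -!scalerAl -[ga * W * W]mulrA WW mulr_algr.
  by rewrite scalerA; apply: IZV; rewrite mulf_neq0 // oppr_eq0 !mulf_neq0.
have {}rho_vec w : mx_congr_mod I (rho (cw_vec w))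
    (mx22 0 (k%:C *: (gam w * de - al * gam w)) 0 0).
  apply: (mx_congr_mod_trans iI (rho_vec w)); rewrite comm_N.
  have [_ _ IMl IMr] := iI.
  apply: mx_congr_mod22; rewrite /congr_mod ?subrr ?subr0.
  - exact: IMl.
  - by rewrite scalerBr scalerAl scalerAr subrr; case: iI.
  - by case: iI.
  - exact/(idealN iI)/IMr.
have qI v : congr_mod I (q_form al de (gam v)) (gam (- B v)).
  have /EI rhoI := rho_rep (cw_minus V) (cw_vec v).
  rewrite cw_bracket_minus_vec in rhoI.
  have := mx_congr_mod_trans iI (mx_congr_mod_sym iI (rho_dualI v)) rhoI.
  have rho_minusI : mx_congr_mod I (rho (cw_minus V)) (mx22 al be 0 de).
    rewrite rho_minus; apply: mx_congr_mod22; try exact: congr_mod_refl.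
    by rewrite /congr_mod subr0.
  move/(mx_congr_mod_trans iI)/(_ (comm_congr _ _ _ _ rho_minusI (rho_vec v))).
  (* The upper right entry of the commutator is [- k] times [q_form al de (gam v)], by [q_formE];
     that of [rho (cw_dual g v)] is [k] times [gam (B v)]. *)
  rewrite mxcomm_mx22 => /(_ 0 1); rewrite /congr_mod !mxE /= !simpl0.
  rewrite -scalerAr -scalerAl -!scalerBr => /(IZV _ _ k0).
  rewrite (gamN Cl_V) opprK q_formE; congr I.
  by rewrite -[gam v * de - _]opprB mulrN mulNr -opprD opprK addrC.
have [c [d [cI dI q_cd]]] := clifford_pair_lift Cl_V bar_V al de iI I1.
(* The normal form contains [bar] of its first parameter and the square root of 2 times the third,
   hence [bar c] and the factor [k] here. *)
exists (bar c), d, (k%:C *: be); rewrite (barK Cl_V bar_V); split.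
  split=> [//|w|]; rewrite (barK Cl_V bar_V); apply/EI.
    apply: (mx_congr_mod_trans iI (rho_vec w)).
    rewrite rscalemx_mx22 !scaler0 mx22N oppr0 -scalerN opprB.
    apply: mx_congr_mod22; try exact: congr_mod_refl.
    rewrite /congr_mod -scalerBr; apply: IZ.
    have ww := congr_mod_refl iI (gam w).
    apply: (congr_modD iI (congr_modM iI ww (congr_mod_sym iI dI))).
    exact/(congr_modN iI)/(congr_modM iI (congr_mod_sym iI cI) ww).
  rewrite rho_minus /rscale scalerA -rmorphM mulfV ?rmorph1 ?scale1r;
    last first.
    by rewrite lt0r_neq0 // sqrtr_gt0 ltr0n.
  apply: mx_congr_mod22; try exact: congr_mod_refl.
  - exact: congr_mod_sym.
  - by rewrite /congr_mod subr0.
  - exact: congr_mod_sym.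
by move=> v; rewrite (q_cd _ _ (qI v)) (gamN Cl_V).
Qed.

(** The normal form, extended linearly by zero on [cw_plus V], is a representation because the map
    [L] below has square [- B] on vectors. *)
Lemma clifford_pair_rep c d e :
    (forall v, q_form (bar c) d (gam v) = - gam (B v)) ->
  exists rho : cw_alg V -> 'M[Cl]_2,
    [/\ simple_clifford_rep g B gam eq rho, rho (cw_plus V) = 0
      & given_by g B gam eq bar c d e rho].
Proof.
move=> q_cd; set k := ((Num.sqrt 2)^-1 : R).
pose L x := bar c * x - x * d.
have LB x y : L (x - y) = L x - L y.
  rewrite /L mulrBr mulrBl !opprB addrACA [RHS]addrACA.
  by congr (_ + _); rewrite addrC.
have LZ (a : R[i]) x : L (a *: x) = a *: L x.
  by rewrite /L -scalerAr -scalerAl scalerBr.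
have LL v : L (L (gam v)) = - gam (B v) by rewrite -q_cd q_formE.
pose e' := (Num.sqrt 2)%:C *: e.
pose p (x : cw_alg V) := let: (phi, (w, _, b)) := x in
  k%:C *: (gam (B (sharp g phi)) - L (gam w)) + b%:C *: e'.
pose rho (x : cw_alg V) := let: (_, (_, _, b)) := x in
  mx22 (b%:C *: bar c) (p x) 0 (b%:C *: d).
have LD x y : L (x + y) = L x + L y.
  by rewrite -{1}[y]opprK LB -[- y]scaleN1r LZ scaleN1r opprK.
have gam0 : gam 0 = 0 by rewrite -(scale0r 0) (gamZ Cl_V) rmorph0 scale0r.
have L0 : L 0 = 0 by rewrite /L mulr0 mul0r subrr.
have p_lin a x y : p (a *: x + y) = a%:C *: p x + p y.
  case: x y => [phi [[w s] b]] [psi [[u t] b']] /=.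
  rewrite !linearP /= !(gamD Cl_V, gamZ Cl_V) LD LZ rmorphD rmorphM /=.
  rewrite opprD addrACA -scalerBr [k%:C *: (_ + _)]scalerDr scalerA.
  rewrite [k%:C * a%:C]mulrC -!scalerA scalerDl -scalerA addrACA.
  by rewrite scalerA -scalerA -scalerDr.
have rho_lin : GRing.linear_for (@rscalemx R Cl) rho.
  move=> a x y; have := p_lin a x y.
  case: x y => [phi [[w s] b]] [psi [[u t] b']].
  move=> pE; rewrite [rho (phi, _)]/rho [rho (psi, _)]/rho rscalemx_mx22.
  rewrite mx22D -pE scaler0 addr0 !scalerA -!scalerDl.
  by rewrite -!(rmorphM, rmorphD).
have L_p phi w s b :
    L (p (phi, (w, s, b))) =
    k%:C *: (L (gam (B (sharp g phi))) + gam (B w)) + b%:C *: L e'.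
  by rewrite LD !LZ LB LL opprK.
have rho_rep x y : rho (cw_bracket g B x y) = mxcomm (rho x) (rho y).
  case: x y => [phi [[w s] b]] [psi [[u t] b']].
  have comm0 (z : Cl) : b%:C *: z * (b'%:C *: z) - b'%:C *: z * (b%:C *: z) = 0.
    by rewrite -!scalerAl -!scalerAr !scalerA mulrC subrr.
  rewrite mxcomm_mx22 !(mul0r, mulr0, addr0, add0r) !comm0 oppr0.
  (* The diagonals of both matrices are multiples of the same pair [(bar c, d)], so the upper right
     entry of the commutator depends on [L] alone. *)
  have commL x y : b%:C *: bar c * y + x * (b'%:C *: d) -
      (b'%:C *: bar c * x + y * (b%:C *: d)) = b%:C *: L y - b'%:C *: L x.
    rewrite /L !scalerBr -!scalerAl -!scalerAr opprB opprD addrACA [RHS]addrACA.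
    by rewrite addrACA; congr (_ + _); rewrite addrC.
  rewrite commL !L_p [LHS]/= !scale0r addr0; congr (mx22 _ _ _ _).
  have -> : sharp g (b *: flat g u - b' *: flat g w) = b *: u - b' *: w.
    by rewrite linearB !linearZ /= !flatK.
  have gamBZ (r r' : R) z z' :
      gam (r *: z - r' *: z') = r%:C *: gam z - r'%:C *: gam z'.
    by rewrite (gamD Cl_V) (gamN Cl_V) !(gamZ Cl_V).
  have BZ (r r' : R) z z' : B (r *: z - r' *: z') = r *: B z - r' *: B z'.
    by rewrite linearB !linearZ.
  rewrite BZ !gamBZ LB !LZ.
  move: (L (gam _)) (L (gam _)) (_ *: L e) => LP LQ Le.
  (* The two terms in [L e] carry the same coefficient [b * b'] with opposite signs and cancel,
     which leaves [e] free. *)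
  rewrite opprB addrACA -scalerDr [- _ - _]addrC -opprD -scalerDr.
  rewrite !(scalerDr _ _ (_ *: Le)) opprD !scalerA [b'%:C * b%:C]mulrC.
  rewrite addrACA subrr addr0 ![_ * k%:C]mulrC -!scalerA -scalerBr.
  by rewrite [gam _ + LP]addrC.
have rho_dual v : rho (cw_dual g v) = spin_rep B gam v.
  rewrite /rho /= flatK /spin_rep rscalemx_mx22.
  by rewrite gam0 L0 subr0 !scale0r !scaler0 addr0.
exists rho; split.
- split=> //; split=> // v x; exact: rho_rep.
- rewrite /rho /= !linear0 gam0 L0 subrr !scale0r scaler0 addr0.
  by apply/matrixP => i j; rewrite !mxE; case: (i == 0); case: (j == 0).
split=> [v|w|].
- by rewrite rho_dual.
- rewrite /rho /= !linear0 gam0 sub0r scalerN !scale0r addr0.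
  by rewrite rscalemx_mx22 !scaler0 mx22N oppr0.
- by rewrite /rho /= !linear0 gam0 L0 subrr scaler0 add0r !scale1r.
Qed.

End CahenWallachTheory.

(** * The annihilator of S(V), and the theorem *)

Section Annihilator.
Variables (R : realType) (Cl : algType R[i]) (S : lmodType Cl).

Definition annihilates (x : Cl) : Prop := forall s : S, x *: s = 0.

Lemma annihilator_ideal : two_sided_ideal annihilates.
Proof.
split=> [s|x y x0 y0 s|a x x0 s|a x x0 s]; first by rewrite scale0r.
- by rewrite scalerDl x0 y0 addr0.
- by rewrite -scalerA x0 scaler0.
- by rewrite -scalerA x0.
Qed.

(** Acting on the pairs [(s, 0)] and [(0, s)] isolates the columns of a matrix. *)
Lemma eq_onP (M N : 'M[Cl]_2) : eq_on S M N <-> mx_congr_mod annihilates M N.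
Proof.
have annB (x y : Cl) :
    congr_mod annihilates x y <-> forall s : S, x *: s = y *: s.
  split=> xy s; last by rewrite scalerBl xy subrr.
  by apply/eqP; rewrite -subr_eq0 -scalerBl xy.
split=> [MN|MN s]; last first.
  have MNs i j (t : S) : M i j *: t = N i j *: t.
    by apply: (annB _ _).1 t; apply: MN.
  by rewrite /mxact !MNs.
rewrite [M]mx22_eta [N]mx22_eta.
by apply: mx_congr_mod22; apply: (annB _ _).2 => s;
  [have [] := MN (s, 0) | have [] := MN (0, s)
  |have [] := MN (s, 0) | have [] := MN (0, s)];
  rewrite /= !scaler0 ?add0r ?addr0.
Qed.

End Annihilator.

Lemma zero_ideal (A : nzRingType) : two_sided_ideal (fun x : A => x = 0).
Proof.
split=> // [x y -> ->|a x ->|a x ->]; by rewrite ?addr0 ?mulr0 ?mul0r.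
Qed.

Theorem theorem3p6
  (R : realType) (V : vectType R) (g : {dot V for idfun})
  (B : 'End(V)) (B_sym : forall v w : V, g (B v) w = g v (B w))
  (Cl : algType R[i]) (gam : V -> Cl) (Cl_V : is_clifford_algebra g gam)
  (bar : {lrmorphism Cl -> Cl}) (bar_V : forall v : V, bar (gam v) = - gam v)
  (S : lmodType Cl) (S_irr : irreducible_module S) :
  [/\ (0 < \dim {:V})%N -> lker B == 0%VS ->
      forall rho : cw_alg V -> 'M[Cl]_2,
        simple_clifford_rep g B gam (@eq_on R Cl S) rho ->
        eq_on S (rho (cw_plus V)) 0 ->
        exists c d e : Cl,
          [/\ given_by g B gam (@eq_on R Cl S) bar c d e rho,
              quadratic_clifford_pair g gam (bar c) d
            & forall v : V, q_form (bar c) d (gam v) = - gam (B v)],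
      (0 < \dim {:V})%N -> lker B == 0%VS ->
      forall rho : cw_alg V -> 'M[Cl]_2,
        simple_clifford_rep g B gam (@eq 'M[Cl]_2) rho ->
        rho (cw_plus V) = 0 ->
        exists c d e : Cl,
          [/\ given_by g B gam (@eq 'M[Cl]_2) bar c d e rho,
              quadratic_clifford_pair g gam (bar c) d
            & forall v : V, q_form (bar c) d (gam v) = - gam (B v)]
    & forall c d e : Cl,
        quadratic_clifford_pair g gam (bar c) d ->
        (forall v : V, q_form (bar c) d (gam v) = - gam (B v)) ->
        exists rho : cw_alg V -> 'M[Cl]_2,
          [/\ simple_clifford_rep g B gam (@eq 'M[Cl]_2) rho,
              simple_clifford_rep g B gam (@eq_on R Cl S) rho,
              rho (cw_plus V) = 0
            & given_by g B gam (@eq 'M[Cl]_2) bar c d e rho]].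
Proof.
have pair_of c d : (forall v, q_form (bar c) d (gam v) = - gam (B v)) ->
    quadratic_clifford_pair g gam (bar c) d.
  (* The endomorphism induced by [q_form] is [- B], symmetric because [B] is. *)
  move=> q_cd; exists (- B) => [v|v w]; rewrite !opp_lfunE.
    by rewrite q_cd (gamN Cl_V).
  by rewrite linearNl linearNr; congr (- _); apply: B_sym.
split=> [dimV kerB rho rho_rep rho_plus|dimV kerB rho rho_rep rho_plus|].
(* A nonzero vector of [S] shows that 1 is not in the annihilator. *)
- have [s s0] := S_irr.1.
  have ann1 : ~ annihilates S 1 by move/(_ s)/eqP; rewrite scale1r (negPf s0).
  have [c [d [e [rhoE q_cd]]]] := clifford_rep_normal_form Cl_V bar_V
    (annihilator_ideal S) ann1 (@eq_onP _ _ S) dimV kerB rho_rep rho_plus.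
  by exists c, d, e; split=> //; apply: pair_of.
- have eqI (M N : 'M[Cl]_2) : M = N <-> mx_congr_mod (fun x => x = 0) M N.
    split=> [-> i j|MN]; first exact: subrr.
    by apply/matrixP => i j; apply/eqP; rewrite -subr_eq0; apply/eqP/MN.
  have [c [d [e [rhoE q_cd]]]] := clifford_rep_normal_form Cl_V bar_V
    (zero_ideal Cl) (elimN eqP (oner_neq0 Cl)) eqI dimV kerB rho_rep rho_plus.
  by exists c, d, e; split=> //; apply: pair_of.
move=> c d e _ q_cd.
have [rho [[[rho_lin rho_dual rho_equiv] rho_rep] rho_plus rho_given]] :=
  clifford_pair_rep Cl_V e q_cd.
exists rho; split=> //; split; first split=> //.
- by move=> v s; rewrite rho_dual.
- by move=> v x s; rewrite rho_equiv.
- by move=> x y s; rewrite rho_rep.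
Qed.
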